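(* Let $\mathcal T$ be a set of tile designs for the triakis tetrahedron with symmetry group the full tetrahedral group $T_d$ (order $24$). Suppose there are $t_{\mathrm{id}}$ tiles, $t_f$ of which are fixed under the (horizontal) reflection of the isosceles triangular face. Then the number of ways of tiling the faces of the triakis tetrahedron up to full tetrahedral symmetry $T_d$ is $$\frac{1}{24}\left(t_{\mathrm{id}}^{12}+8\,t_{\mathrm{id}}^4+3\,t_{\mathrm{id}}^6+6\,t_{\mathrm{id}}^5t_f^2+6\,t_{\mathrm{id}}^3\right).$$
   Context: Tilings. Let $P$ be a polyhedron with set of faces $\mathcal F$ and let $\mathcal A$ be a group of isometries of $P$, acting on $\mathcal F$. A set of tile designs is a finite set $\mathcal T$ together with a group action of $\mathcal A$ on $\mathcal T\times\mathcal F$ lying over the action on $\mathcal F$ (so $A\cdot(T,F)=(T',A\cdot F)$ for some $T'\in\mathcal T$). A tiling is a map $\tau:\mathcal F\to\mathcal T$; $\mathcal A$ acts on tilings by moving graphs: $A\cdot\tau$ is the tiling with $((A\cdot\tau)(A\cdot F),A\cdot F)=A\cdot(\tau(F),F)$ for all $F$. The number of ways of tiling up to $\mathcal A$ is the number of $\mathcal A$-orbits on the set of tilings. The induced symmetry group $G$ of a face $F$ is the group of isometries of $F$ realized by elements of the stabilizer $\mathcal A_F$; for $g\in G$, $t_g$ is the number of $T\in\mathcal T$ with $g\cdot(T,F)=(T,F)$, where $g$ acts via the element of $\mathcal A_F$ inducing it. Since $\mathcal A$ acts transitively on faces, $t_g$ does not depend on the choice of $F$. In particular $t_{\mathrm{id}}=|\mathcal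 T|$. Polyhedron and group. Here $\mathcal A=T_d$ is the group of order $24$ generated by the matrices $R_0=\begin{pmatrix}0&1&0\\1&0&0\\0&0&1\end{pmatrix}$, $R_1=\begin{pmatrix}1&0&0\\0&0&1\\0&1&0\end{pmatrix}$, $R_2=\begin{pmatrix}0&-1&0\\-1&0&0\\0&0&1\end{pmatrix}$. The triakis tetrahedron (the Catalan solid dual to the truncated tetrahedron) is the convex hull of the $T_d$-orbits of $(1,1,1)$ and $(-3/5,-3/5,-3/5)$ ($8$ vertices, $12$ isosceles triangular faces). The induced symmetry group of a face is $\langle f\mid f^2=e\rangle$, with $f$ the reflection of the isosceles triangle. *)

(* Defs.v *)
From mathcomp Require Import all_boot all_order all_algebra.
From mathcomp Require Import all_classical reals convex.

Set Implicit Arguments.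
Unset Strict Implicit.
Unset Printing Implicit Defensive.

Import Order.TTheory GRing.Theory Num.Theory.

Local Open Scope classical_set_scope.
Local Open Scope ring_scope.

Section Geometry.
Variable R : realType.
Implicit Types (u v w x y : 'cV[R]_3) (A B : 'M[R]_3) (F P S : set 'cV[R]_3).

Definition convex_hull S : set 'cV[R]_3 := smallest (@convex_set R 'cV[R]_3) S.

(* Not the library's norm on matrices, which is the sup norm. *)
Definition edist x y : R := Num.sqrt (\sum_i (x i 0 - y i 0) ^+ 2).

Definition affinely_independent u v w : Prop :=
  \rank (row_mx (v - u) (w - u)) = 2%N.

(* The faces of a polyhedron are its two-dimensional ones: intersections with
   a supporting plane that are not contained in a line. *)
Definition faces P : set (set 'cV[R]_3) :=
  [set F | exists (a : 'rV[R]_3) (b : R),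
    [/\ a != 0,
        forall x, P x -> (a *m x) 0 0 <= b,
        F = P `&` [set x | (a *m x) 0 0 = b]
      & exists u v w, [/\ F u, F v, F w & affinely_independent u v w]]].

Definition matrix_group (G : set 'M[R]_3) : Prop :=
  [/\ G 1%:M,
      forall A B, G A -> G B -> G (A *m B)
    & forall A, G A -> A \in unitmx /\ G (invmx A)].

Definition generated_group (S : set 'M[R]_3) : set 'M[R]_3 :=
  smallest matrix_group S.

(* The 3 x 3 matrix with the given rows. *)
Definition mx3 (s : seq (seq R)) : 'M[R]_3 :=
  \matrix_(i < 3, j < 3) nth 0 (nth [::] s i) j.

Definition Td : set 'M[R]_3 :=
  generated_group [set mx3 [:: [:: 0; 1; 0];
                               [:: 1; 0; 0];
                               [:: 0; 0; 1]];
                       mx3 [:: [:: 1; 0; 0];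
                               [:: 0; 0; 1];
                               [:: 0; 1; 0]];
                       mx3 [:: [:: 0; -1; 0];
                               [:: -1; 0; 0];
                               [:: 0; 0; 1]]].

Definition orbit_of (G : set 'M[R]_3) x : set 'cV[R]_3 :=
  [set A *m x | A in G].

(* const_mx c is the point (c, c, c). *)
Definition triakis_tetrahedron : set 'cV[R]_3 :=
  convex_hull (orbit_of Td (const_mx 1) `|` orbit_of Td (const_mx (- (3 / 5)))).

(* A is an element of the stabilizer of F in G that restricts to f on F. *)
Definition induces (G : set 'M[R]_3) F (f : 'cV[R]_3 -> 'cV[R]_3) A : Prop :=
  [/\ G A, mulmx A @` F = F & forall x, F x -> f x = A *m x].

Definition induced_symmetry_group (G : set 'M[R]_3) F :
    set ('cV[R]_3 -> 'cV[R]_3) :=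
  [set f | exists A, induces G F f A].

(* F is an isosceles triangle with apex u and base vw, and f restricts to the
   isometry of F that fixes the apex and exchanges the base vertices. *)
Definition isosceles_reflection F (f : 'cV[R]_3 -> 'cV[R]_3) : Prop :=
  exists u v w,
    [/\ affinely_independent u v w,
        F = convex_hull [set u; v; w],
        edist u v = edist u w,
        f @` F = F /\ (forall x y, F x -> F y -> edist (f x) (f y) = edist x y)
      & [/\ f u = u, f v = w & f w = v]].

End Geometry.

(* An action of G on T * faces P that lies over the action of G on faces P;
   the values of tile_act outside G are irrelevant. *)
Record tile_designs (R : realType) (G : set 'M[R]_3) (P : set 'cV[R]_3)
    (T : finType) := TileDesigns {
  tile_act :> 'M[R]_3 -> T * faces P -> T * faces P;
  tile_act1 : forall z, tile_act 1%:M z = z;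
  tile_actM : forall A B z, G A -> G B ->
    tile_act (A *m B) z = tile_act A (tile_act B z);
  tile_act_over : forall A z, G A ->
    val (tile_act A z).2 = mulmx A @` val z.2
}.

Section Tilings.
Variables (R : realType) (G : set 'M[R]_3) (P : set 'cV[R]_3) (T : finType).
Variable D : tile_designs G P T.

Definition tiling : Type := faces P -> T.

(* sigma = A . tau *)
Definition moves_tiling (A : 'M[R]_3) (tau sigma : tiling) : Prop :=
  forall F F' : faces P, val F' = mulmx A @` val F ->
    (sigma F', F') = D A (tau F, F).

Definition tiling_orbit (tau : tiling) : set tiling :=
  [set sigma | exists2 A, G A & moves_tiling A tau sigma].

Definition tiling_orbits : set (set tiling) := range tiling_orbit.

(* t_g, for g in the induced symmetry group of F *)
Definition fixed_tiles (F : faces P) (g : 'cV[R]_3 -> 'cV[R]_3) : nat :=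
  #|[set t : T | `[< exists2 A, induces G (val F) g A
                              & D A (t, F) = (t, F) >]]%SET|.

End Tilings.

(* Main.v *)
Require Import Defs.
From mathcomp Require Import all_boot all_order all_algebra all_fingroup finmap.
From mathcomp Require Import all_classical reals convex interval_inference.
From mathcomp Require Import ring lra.

Set Implicit Arguments.
Unset Strict Implicit.
Unset Printing Implicit Defensive.

Import Order.TTheory GRing.Theory Num.Theory.

(** The formula is an orbit count by the Cauchy-Frobenius lemma: 24 times the
    number of tilings up to symmetry is the sum, over the 24 symmetries, of the
    number of tilings that each of them fixes.

    A symmetry moves the faces in cycles.  A tiling fixed by it is determined by
    the tile on one face of each cycle, and that tile may be any design that is
    fixed when the symmetry has gone once around the cycle
    ([card_equivariant]).  The power of the symmetry that goes once around is
    either the identity, which leaves |T| choices, or a nontrivial symmetry that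
    preserves the face, hence the reflection of that face, which leaves t_f
    choices.

    To make the cycles explicit, T_d is identified with the symmetric group on
    the four vertices v_0, ..., v_3 of a regular tetrahedron, the permutation s
    becoming the matrix 1/4 (sum_i v_(s i) v_i^T) ([TdE]).  The solid has these
    four vertices and the four points -3/5 v_i.  A supporting plane is given by
    the values of a linear form on the v_i, which sum to zero; a short linear
    argument shows that if the plane meets three vertices of the solid, then
    these are -3/5 v_i, v_k and v_l with i, k, l distinct
    ([three_tight_vertices]).  With j the fourth index, the faces therefore
    correspond to the twelve ordered pairs i <> j ([faces_triakisP],
    [face_faces], [face_inj]), and T_d permutes them as the symmetric group
    permutes ordered pairs ([symm_face]).  Two nontrivial permutations of four
    points that fix the same two points are equal ([pair_act_stab]), so each
    face has a single nontrivial stabilizing symmetry; all of them are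
    conjugate, so they fix the same number t_f of designs
    ([card_fixed_designs_reflection]).

    What remains concerns permutations of four points acting on ordered pairs.
    A transposition fixes two pairs and moves the other ten in five 2-cycles.
    Every other permutation acts with all cycles of the same length, its order.
    The 1 + 8 + 3 + 6 + 6 permutations by cycle type give the five terms of the
    formula ([card_orbits]). *)

(** * Colourings equivariant under a self-map *)

Section Equivariant.
Variables (I T : finType) (h : I -> I) (H : T * I -> T * I).
Hypothesis h_inj : injective h.
Hypothesis over : forall z, (H z).2 = h z.2.

Definition equivariant (tau : {ffun I -> T}) :=
  [forall k, H (tau k, k) == (tau (h k), h k)].

(** The colours at [k] that survive one full turn of the cycle of [k]. *)
Definition return_fixed k := [pred t | iter (fingraph.order h k) H (t, k) == (t, k)].

Lemma iter_over n z : (iter n H z).2 = iter n h z.2.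
Proof. by elim: n => //= n <-; rewrite over. Qed.

Lemma equivariant_iter tau k n : equivariant tau ->
  iter n H (tau k, k) = (tau (iter n h k), iter n h k).
Proof. by move=> /forallP E; elim: n => //= n ->; apply/eqP. Qed.

(** An equivariant colouring is determined by its values at one representative
    per cycle, since the value at [h^n r] is obtained by applying [H] n times at
    [r].  A choice at [r] extends consistently to the cycle exactly when going
    once around returns to it. *)
Lemma card_equivariant :
  #|equivariant| = \prod_(k in froots h) #|return_fixed k|.
Proof.
have conn k : fconnect h (froot h k) k.
  by rewrite (fconnect_sym h_inj) connect_root.
have rt k : froot h k \in froots h by exact: roots_root (fconnect_sym h_inj) _.
have [T0|/card_gt0P[t0 _]] := posnP #|T|.
  have no0 (P : pred T) : #|P| = 0 by apply/eqP; rewrite -leqn0 -T0 max_card.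
  have [k0 _|I0] := pickP (@predT I); last first.
    rewrite big_pred0 => [|k]; last by have := I0 k.
    rewrite (eq_card (B := {ffun I -> T})) ?card_ffun ?(eq_card0 I0) // => tau.
    by apply/forallP => k; have := I0 k.
  rewrite (bigD1 (froot h k0)) //= no0 mul0n.
  by apply: eq_card0 => tau; have := card0_eq T0 (tau k0); rewrite inE.
(* [t0] pads the choices at representatives to functions on all sites. *)
transitivity #|pfamily t0 (froots h) return_fixed|; last first.
  by rewrite card_pfamily foldrE big_map big_enum.
pose res (tau : {ffun I -> T}) :=
  [ffun k => if k \in froots h then tau k else t0].
pose path_to k := findex h (froot h k) k.
have path_toE k : iter (path_to k) h (froot h k) = k by exact: iter_findex.
rewrite -(card_in_image (f := res)) => [|tau sig /= tauE sigE eq_res].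
  apply: eq_card => g; apply/fintype.imageP/pfamilyP => [[tau tauE ->]|[g0 gfix]].
    split=> [|k kr]; first by apply/supportP=> k /negPf kr; rewrite ffunE kr.
    by rewrite !inE ffunE kr equivariant_iter // iter_order.
  (* Conversely, spread the choices along the cycles. *)
  pose tau := [ffun k => (iter (path_to k) H (g (froot h k), froot h k)).1].
  have tauP k n : iter n H (g (froot h k), froot h k) =
      (tau (iter n h (froot h k)), iter n h (froot h k)).
    set r := froot h k; set z := (g r, r); set N := fingraph.order h r.
    (* Only the residue of [n] modulo the length of the cycle matters. *)
    have period m : iter (m %% N) H z = iter m H z.
      rewrite [in RHS](divn_eq m N) addnC iterD; congr iter.
      have := gfix r (rt k); rewrite !inE => /eqP zN.
      by elim: (m %/ N) => //= q IH; rewrite mulSn iterD -IH zN.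
    have rE m : froot h (iter m h r) = r.
      rewrite -[RHS](eqP (rt k)); apply/eqP.
      by rewrite (root_connect (fconnect_sym h_inj)) (fconnect_sym h_inj) fconnect_iter.
    have iterE : iter n h r = iter (n %% N) h r.
      by have /(congr1 snd) := period n; rewrite !iter_over.
    have modE : path_to (iter n h r) = n %% N.
      by rewrite /path_to rE iterE findex_iter // ltn_mod fingraph.order_gt0.
    apply: injective_projections => /=; last by rewrite iter_over.
    by rewrite ffunE rE modE period.
  have rootE k : k \in froots h -> tau k = g k.
    by move=> kr; have := tauP k 0; rewrite /= (eqP kr) => -[].
  exists tau.
    apply/forallP=> k; rewrite -(path_toE k).
    by rewrite -tauP -!iterS tauP.
  apply/ffunP=> k; rewrite ffunE; case: ifP => [/rootE-> //|kNr].
  by move/supportP: g0; apply; rewrite kNr.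
apply/ffunP=> k; rewrite -(path_toE k).
have eq_root : tau (froot h k) = sig (froot h k).
  by have := congr1 (fun f : {ffun I -> T} => f (froot h k)) eq_res; rewrite !ffunE rt.
have := equivariant_iter (froot h k) (path_to k) tauE.
by rewrite eq_root (equivariant_iter _ _ sigE) => -[].
Qed.

Lemma order_minimal k n : 0 < n -> iter n h k = k ->
  (forall m, 0 < m < n -> iter m h k != k) -> fingraph.order h k = n.
Proof.
move=> n_gt0 hn hmin; apply/eqP; rewrite eqn_leq; apply/andP; split; last first.
  rewrite leqNgt; apply/negP => lt_n.
  have /negP[] := hmin _ (introT andP (conj (fingraph.order_gt0 h k) lt_n)).
  by apply/eqP; exact: iter_order.
rewrite leqNgt; apply/negP => lt_n.
by have := findex_iter lt_n; rewrite hn findex0 => n0; rewrite -n0 in n_gt0.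
Qed.

(** The case where every cycle is either a fixed point with [b] admissible
    colours or has the common length [n] and [t] admissible colours. *)
Lemma card_equivariant_semiregular (B : {pred I}) n t b :
  0 < n -> {in B, forall k, h k = k /\ #|return_fixed k| = b} ->
  {in [predC B], forall k, fingraph.order h k = n /\ #|return_fixed k| = t} ->
  #|equivariant| = b ^ #|B| * t ^ ((#|I| - #|B|) %/ n).
Proof.
move=> n_gt0 inB outB.
have closedB : fclosed h B.
  move=> k _ /eqP <-; case: (boolP (k \in B)) => kB.
    by rewrite (inB _ kB).1 kB.
  apply/esym/negbTE/negP => hkB; case/negP: kB.
  by rewrite -(h_inj (inB _ hkB).1).
have closedC : fclosed h [predC B] by move=> x y /closedB; rewrite !inE => ->.
rewrite card_equivariant (bigID (mem B)) /=; congr (_ * _).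
  rewrite (eq_bigr (fun=> b)) => [|k /andP[_ /inB[]] //].
  rewrite big_const iter_muln_1; congr (b ^ _).
  rewrite -[RHS](@fcard_order_set _ _ h_inj 1 B) //.
    by rewrite muln1; apply: eq_card => k; rewrite !inE.
  by apply/fintype.subsetP => k /inB[hk _]; rewrite inE (@order_minimal _ 1) // => -[|].
rewrite (eq_bigr (fun=> t)) => [|k /andP[_ kB]]; last by have [] := outB k kB.
rewrite big_const iter_muln_1; congr (t ^ _).
rewrite -(cardC B) addKn -(fcard_order_set h_inj (n := n) _ closedC) ?mulnK //.
by apply/fintype.subsetP => k /outB[hk _]; rewrite inE hk.
Qed.
End Equivariant.

(** * The action of a finite group on tilings *)

Section TilingAction.
Import GroupScope.
Variables (gT : finGroupType) (I T : finType).
Variables (b : {action gT &-> I}) (a : {action gT &-> (T * I)}).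
Hypothesis a_over : forall z g, (a z g).2 = b z.2 g.

(** The tiling whose graph is the image of the graph of [tau]: the tile placed on
    the face [k] comes from the face that [g] sends to [k]. *)
Definition tiling_act (tau : {ffun I -> T}) g : {ffun I -> T} :=
  [ffun k => (a (tau (b k g^-1), b k g^-1) g).1].

Lemma tiling_actP (tau : {ffun I -> T}) g k :
  a (tau k, k) g = (tiling_act tau g (b k g), b k g).
Proof.
by apply: injective_projections; rewrite /= ?a_over // ffunE -actM mulgV act1.
Qed.

Lemma tiling_act_is_action : is_action [set: gT] tiling_act.
Proof.
apply: is_total_action => [tau|tau x y]; apply/ffunP => k.
  by rewrite ffunE invg1 !act1.
rewrite ffunE invMg [in LHS]actM actM tiling_actP -actM.
by rewrite tiling_actP actM !actKV.
Qed.
Canonical tiling_action := Action tiling_act_is_action.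

Lemma tiling_fixE tau g :
  (tau \in 'Fix_tiling_action[g]) = (tau \in equivariant (b^~ g) (a^~ g)).
Proof.
apply/afix1P/forallP => [fix_tau k | eqv].
  by rewrite /= tiling_actP; have /= -> := fix_tau.
apply/ffunP => k; rewrite -[k](actKV b g).
by have := eqP (eqv (b k g^-1)); rewrite tiling_actP => -[].
Qed.

Definition fixed_designs k g := [pred t | a (t, k) g == (t, k)].

(** Moving by [x] carries the designs fixed by [g] to those fixed by [g ^ x]. *)
Lemma card_fixed_designs_conj k g x :
  #|fixed_designs (b k x) (g ^ x)| = #|fixed_designs k g|.
Proof.
have le_conj l y z : #|fixed_designs l y| <= #|fixed_designs (b l z) (y ^ z)|.
  pose f t := (a (t, l) z).1.
  have fE t : a (t, l) z = (f t, b l z).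
    by apply: injective_projections => //; rewrite a_over.
  rewrite -(fintype.card_image (f := f)) => [|t t' ff].
    apply/subset_leq_card/fintype.subsetP => _ /fintype.imageP[t tfix ->].
    move: tfix; rewrite !inE -fE -actM conjgE.
    by rewrite mulKVg actM => /eqP ->.
  have: a (t, l) z = a (t', l) z by rewrite !fE ff.
  by move/act_inj => [].
apply/eqP; rewrite eqn_leq le_conj andbT.
by have := le_conj (b k x) (g ^ x) x^-1; rewrite actK conjgK.
Qed.

End TilingAction.

(** * Permutations of four points acting on ordered pairs *)

Section SymmetricGroup.
Import GroupScope.

Definition opair := {p : 'I_4 * 'I_4 | p.1 != p.2}.

Lemma pair_act_subproof (p : opair) (s : 'S_4) :
  s (val p).1 != s (val p).2.
Proof. by rewrite (inj_eq perm_inj); case: p. Qed.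

Definition pair_act (p : opair) (s : 'S_4) : opair :=
  Sub (s (val p).1, s (val p).2) (pair_act_subproof p s).

Lemma pair_act_is_action : is_action [set: 'S_4] pair_act.
Proof.
by apply: is_total_action => [p|p s t]; apply: val_inj; case: p => -[i j] ?;
  rewrite /= ?perm1 ?permM.
Qed.
Canonical pair_action := Action pair_act_is_action.

Lemma card_pairs (Q : pred ('I_4 * 'I_4)) :
  #|[pred p : opair | Q (val p)]|
  = \sum_(i < 4) \sum_(j < 4) ((i != j) && Q (i, j) : nat).
Proof.
rewrite pair_big /= -(fintype.card_image val_inj).
rewrite (eq_card (B := [pred q | (q.1 != q.2) && Q q])) => [|q].
  rewrite -sum1_card big_mkcond; apply: eq_bigr => -[i j] _ /=.
  by rewrite !inE /=; case: ifP.
rewrite !inE; apply/fintype.imageP/andP => [[p Qp ->]|[q12 Qq]].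
  by split => //; case: p Qp.
by exists (Sub q q12).
Qed.

Lemma card_pair : #|{: opair}| = 12.
Proof.
by rewrite (card_pairs xpredT) !big_ord_recl !big_ord0.
Qed.

(** One-line notation turns questions about all permutations of four points into
    computations on 24 explicit lists. *)
Definition one_line (s : 'S_4) : seq nat := [seq val (s i) | i <- enum 'I_4].

Lemma nth_one_line s (i : 'I_4) : nth 0 (one_line s) i = s i.
Proof. by rewrite (nth_map i) ?size_enum_ord // nth_ord_enum. Qed.

Lemma one_line_inj : injective one_line.
Proof.
by move=> s t st; apply/permP => i; apply: val_inj; rewrite /= -!nth_one_line st.
Qed.

Lemma perm_one_line : perm_eq [seq one_line s | s : 'S_4] (permutations (iota 0 4)).
Proof.
have sub : {subset [seq one_line s | s : 'S_4] <= permutations (iota 0 4)}.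
  move=> _ /fintype.imageP[s _ ->]; rewrite mem_permutations -val_enum_ord.
  rewrite /one_line (map_comp val s); apply: perm_map.
  apply: uniq_perm; rewrite ?enum_uniq ?(map_inj_uniq perm_inj) ?enum_uniq //.
  move=> i; rewrite mem_enum; apply/mapP.
  by exists (s^-1 i); rewrite ?mem_enum ?permKV.
have U : uniq [seq one_line s | s : 'S_4].
  by rewrite map_inj_uniq ?enum_uniq //; exact: one_line_inj.
apply: uniq_perm; rewrite ?permutations_uniq //.
by case: (uniq_min_size U sub); rewrite // size_image card_Sn.
Qed.

Lemma sum_one_line (F : seq nat -> nat) :
  \sum_s F (one_line s) = \sum_(l <- permutations (iota 0 4)) F l.
Proof. by rewrite -(perm_big _ perm_one_line) big_map big_enum. Qed.

(** The order of a permutation given in one-line notation; the orders of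
    permutations of four points are 1, 2, 3 and 4. *)
Definition period l :=
  (find (fun n => all (fun i => iter n (nth 0 l) i == i) (iota 0 4)) (iota 1 4)).+1.

(** The number of pairs at which only designs with reflection symmetry are
    admissible.  The identity is set apart: it fixes all the pairs, but imposes
    nothing on the designs. *)
Definition fixed_pairs l : nat :=
  if l == iota 0 4 then 0 else
  sumn [seq sumn [seq ((i != j) && (nth 0 l i == i) && (nth 0 l j == j) : nat)
                 | j <- iota 0 4] | i <- iota 0 4].

Lemma iter_one_line s (i : 'I_4) n : iter n (nth 0 (one_line s)) i = (s ^+ n) i.
Proof.
by elim: n => [|n IH]; rewrite ?perm1 //= IH nth_one_line expgSr permM.
Qed.

Lemma one_line1 s : (one_line s == iota 0 4) = (s == 1).
Proof.
rewrite -(inj_eq one_line_inj) -val_enum_ord; congr (_ == _).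
by apply: eq_map => i; rewrite perm1.
Qed.

(** A pair that is not fixed by [s], or any pair when [s] is the identity, lies in
    a cycle whose length is the order of [s].  This is what makes every
    permutation act semiregularly outside its fixed pairs. *)
Lemma period_spec (s : 'S_4) : let n := period (one_line s) in
  s ^+ n = 1 /\ forall i j, i != j -> 
     [/\ s != 1, s i = i & s j = j]
  \/ forall m, 0 < m < n -> (s ^+ m) i = i -> (s ^+ m) j = j -> False.
Proof.
pose check l := let n := period l in
  all (fun i => iter n (nth 0 l) i == i) (iota 0 4) &&
  all (fun i => all (fun j => [|| i == j,
    [&& l != iota 0 4, nth 0 l i == i & nth 0 l j == j]
    | all (fun m => ~~ ((iter m (nth 0 l) i == i) && (iter m (nth 0 l) j == j)))
        (iota 1 n.-1)]) (iota 0 4)) (iota 0 4).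
have: check (one_line s).
  have: all check (permutations (iota 0 4)) by vm_compute.
  by move/allP; apply; rewrite -(perm_mem perm_one_line); apply/fintype.imageP; exists s.
have inI (i : 'I_4) : val i \in iota 0 4 by rewrite mem_iota /=.
rewrite /check; set n := period _; case/andP => /allP s_n /allP free; split.
  apply/permP => i; apply: val_inj; rewrite perm1 /= -iter_one_line.
  exact: (eqP (s_n _ (inI i))).
move=> i j ij; have /allP/(_ _ (inI j)) := free _ (inI i).
rewrite !nth_one_line one_line1 => /or3P[|/and3P[s1 /eqP si /eqP sj]|/allP minP].
- by rewrite (inj_eq val_inj) (negPf ij).
- by left; split=> //; apply: val_inj.
right=> m /andP[m_gt0 m_lt] mi mj.
have m_in : m \in iota 1 n.-1 by rewrite mem_iota m_gt0 add1n; exact: m_lt.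
by case/negP: (minP _ m_in); rewrite !iter_one_line mi mj !eqxx.
Qed.

Lemma card_fixed_pairs (s : 'S_4) :
  #|[pred p : opair | (s != 1) && (pair_act p s == p)]| = fixed_pairs (one_line s).
Proof.
rewrite /fixed_pairs one_line1; have [_|_] := eqVneq s 1.
  exact: eq_card0.
pose Q (p : 'I_4 * 'I_4) := (s p.1 == p.1) && (s p.2 == p.2).
rewrite (eq_card (B := [pred p | Q (val p)])) => [|[[i j] ij]]; last first.
  by rewrite !inE -val_eqE.
rewrite card_pairs sumnE big_map -[iota 0 4]/(index_iota 0 4) big_mkord.
apply: eq_bigr => i _; rewrite sumnE big_map big_mkord.
by apply: eq_bigr => j _; rewrite !nth_one_line -andbA.
Qed.

End SymmetricGroup.

Lemma ord4_complement (i j : 'I_4) : i != j ->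
  exists k l, uniq [:: i; j; k; l] /\ forall x, x \in [:: i; j; k; l].
Proof.
move=> ij; have: #|~: [set i; j]| = 2.
  by apply/eqP; rewrite -(eqn_add2l #|[set i; j]|) cardsC cards2 ij card_ord.
move/eqP/cards2P => [k [l [kl E]]]; exists k, l.
have mem x : (x \in [set k; l]) = (x \notin [set i; j]) by rewrite -E inE.
split; last by move=> x; have := mem x; rewrite !inE; do 4!case: (x == _).
have := mem k; have := mem l; rewrite !inE !eqxx orbT /= !negb_or kl ij.
rewrite (eq_sym k) (eq_sym k) (eq_sym l) (eq_sym l).
by move=> /esym/andP[-> ->] /esym/andP[-> ->].
Qed.

Section PairAction.
Import GroupScope.

Lemma pair_act_trans (p q : opair) : exists s, pair_act p s = q.
Proof.
case: p q => -[i j] /= ij [[i' j'] /= ij'].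
pose s := tperm i i'; exists (s * tperm (s j) j').
apply: val_inj; rewrite /= !permM tpermL tpermL tpermD //.
  by rewrite -(tpermL i i') (inj_eq perm_inj) eq_sym.
by rewrite eq_sym.
Qed.

(** A nontrivial permutation that fixes two of the four points can only exchange
    the other two. *)
Lemma pair_act_stab (p : opair) (s t : 'S_4) : s != 1 -> t != 1 ->
  pair_act p s = p -> pair_act p t = p -> s = t.
Proof.
case: p => -[i j] /= ij.
have [k [l [U cover]]] := ord4_complement ij.
have swap (u : 'S_4) : u != 1 -> u i = i -> u j = j -> u k = l /\ u l = k.
  move=> u1 ui uj; move: U; rewrite /= !inE !negb_or.
  move=> /and4P[/and3P[_ ik il] /andP[jk jl] kl _].
  have notij x : x != i -> x != j -> (u x == k) || (u x == l).
    move=> xi xj; have := cover (u x); rewrite !inE.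
    by rewrite -{1}ui -{1}uj !(inj_eq perm_inj) (negPf xi) (negPf xj).
  have uk : u k = l.
    have /orP[/eqP uk|/eqP//] : (u k == k) || (u k == l) by apply: notij; rewrite eq_sym.
    have /orP[/eqP ul|/eqP ul] : (u l == k) || (u l == l) by apply: notij; rewrite eq_sym.
      by case/eqP: kl; apply: (@perm_inj _ u); rewrite uk ul.
    case/eqP: u1; apply/permP => x; rewrite perm1; have := cover x.
    by rewrite !inE => /or4P[]/eqP->.
  split=> //.
  have /orP[/eqP //|/eqP ul] : (u l == k) || (u l == l) by apply: notij; rewrite eq_sym.
  by case/eqP: kl; apply: (@perm_inj _ u); rewrite uk ul.
move=> s1 t1 /(congr1 val)[si sj] /(congr1 val)[ti tj].
have [[sk sl] [tk tl]] := (swap _ s1 si sj, swap _ t1 ti tj).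
by apply/permP => x; have := cover x; rewrite !inE => /or4P[]/eqP->; congruence.
Qed.
End PairAction.

(** * Counting the orbits of tilings *)

Section Count.
Import GroupScope.

Variables (T : finType) (a : {action 'S_4 &-> (T * opair)}) (t_f : nat).
Hypothesis a_over : forall z (s : 'S_4), (a z s).2 = pair_act z.2 s.
Hypothesis card_reflection : forall p (s : 'S_4), s != 1 -> pair_act p s = p ->
  #|fixed_designs a p s| = t_f.

Local Notation to := (tiling_action a_over).

Lemma card_fixed_tilings (s : 'S_4) : let l := one_line s in
  #|'Fix_to[s]|
  = (t_f ^ fixed_pairs l * #|T| ^ ((12 - fixed_pairs l) %/ period l))%N.
Proof.
have [s_per orbs] := period_spec s; move: s_per orbs.
set n := period _ => s_per orbs l.
rewrite (eq_card (fun tau => tiling_fixE a_over tau s)) -card_fixed_pairs -card_pair.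
apply: card_equivariant_semiregular => //.
- exact: act_inj.
- move=> p; rewrite inE => /andP[s1 /eqP ps]; split=> //.
  have ord_p : fingraph.order (pair_act^~ s) p = 1%N.
    by apply: order_minimal => // [|[|]//]; exact: (@act_inj _ _ _ pair_action).
  rewrite -(card_reflection s1 ps).
  by rewrite /return_fixed ord_p.
move=> p; rewrite !inE => pB.
have ord_p : fingraph.order (pair_act^~ s) p = n.
  apply: order_minimal => //; first exact: act_inj.
    by rewrite -(actX pair_action) s_per act1.
  move=> m m_lt; rewrite -(actX pair_action).
  have p12 := valP p; case: (orbs _ _ p12) => [[s1 si sj]|].
    by case/negP: pB; rewrite s1; apply/eqP/val_inj; rewrite /= si sj -surjective_pairing.
  move=> /(_ m m_lt) free; apply/eqP => /(congr1 val) e.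
  exact: free (congr1 fst e) (congr1 snd e).
split=> //; rewrite /return_fixed ord_p; apply: eq_card => t.
by transitivity true => //; apply/eqP; rewrite -(actX a _ s n) s_per act1.
Qed.

(** The Cauchy-Frobenius lemma, with the sum over the group evaluated in one-line
    notation. *)
Lemma card_orbits :
  (#|orbit to [set: 'S_4] @: [set: {ffun opair -> T}]| * 24
  = #|T| ^ 12 + 8 * #|T| ^ 4 + 3 * #|T| ^ 6 + 6 * #|T| ^ 5 * t_f ^ 2 + 6 * #|T| ^ 3)%N.
Proof.
have -> : 24 = #|[set: 'S_4]| by rewrite cardsT card_Sn.
rewrite -Frobenius_Cauchy; last by apply/actsP => s _ tau; rewrite !inE.
under eq_bigr => s _ do rewrite finset.setTI card_fixed_tilings.
rewrite (eq_bigl xpredT) => [|s]; last by rewrite inE.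
pose cycles l := (fixed_pairs l, (12 - fixed_pairs l) %/ period l).
pose weight e := (t_f ^ e.1 * #|T| ^ e.2)%N.
rewrite (sum_one_line (fun l => weight (cycles l))).
rewrite -(big_map cycles xpredT weight).
(* The exponents of t_f and |T| for each cycle type, with multiplicities:
   the identity, 3-cycles, double transpositions, transpositions, 4-cycles. *)
pose types := nseq 1 (0, 12) ++ nseq 8 (0, 4) ++ nseq 3 (0, 6)
  ++ nseq 6 (2, 5) ++ nseq 6 (0, 3).
rewrite (perm_big types); last by vm_compute.
rewrite !big_cat !big_nseq !iter_addn /weight /= !expn0.
ring.
Qed.
End Count.

Local Open Scope classical_set_scope.
Local Open Scope ring_scope.

(** * Convex hulls of finite families *)

Section HullBasics.
Variable R : realType.

Lemma convE (x y : convex_lmodType 'cV[R]_3) (l : {i01 R}) :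
  conv l x y = l%:num *: (x : 'cV[R]_3) + (1 - l%:num) *: (y : 'cV[R]_3).
Proof. by []. Qed.

Lemma convex_hull_convex (S : set 'cV[R]_3) : @convex_set R 'cV[R]_3 (convex_hull S).
Proof.
move=> x y l /set_mem xS /set_mem yS; apply/mem_set => C [Cc SC].
by apply/set_mem/Cc; apply/mem_set; [apply: xS|apply: yS].
Qed.

Lemma convex_hull_finite (Q : finType) (pt : Q -> 'cV[R]_3) x :
  convex_hull (range pt) x -> exists c : Q -> R,
  [/\ forall q, 0 <= c q, \sum_q c q = 1 & x = \sum_q c q *: pt q].
Proof.
apply: (smallest_sub (X := [set x | _])) => [y z l|_ [q _ <-]] /=.
  move=> /set_mem[c [c0 c1 ->]] /set_mem[d [d0 d1 ->]]; apply/mem_set.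
  have [l0 l1] : 0 <= l%:num /\ 0 <= 1 - l%:num by rewrite subr_ge0.
  exists (fun q => l%:num * c q + (1 - l%:num) * d q); split=> [q||].
  - by rewrite addr_ge0 ?mulr_ge0.
  - by rewrite big_split /= -!mulr_sumr c1 d1 !mulr1 addrC subrK.
  rewrite convE !scaler_sumr -big_split /=.
  by apply: eq_bigr => q _; rewrite [RHS]scalerDl !scalerA.
exists (fun p => (p == q)%:R); split=> [p||]; first exact: ler0n.
  by rewrite (bigD1 q) //= eqxx big1 ?addr0 // => p /negPf ->.
rewrite (bigD1 q) //= eqxx scale1r big1 ?addr0 // => p /negPf ->.
by rewrite scale0r.
Qed.

(** A dual pair of linear forms witnesses independence. *)
Lemma rank2_of_dual (r1 r2 : 'rV[R]_3) (x y : 'cV[R]_3) :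
  (r1 *m x) 0 0 = 1 -> (r1 *m y) 0 0 = 0 -> (r2 *m x) 0 0 = 0 -> (r2 *m y) 0 0 = 1 ->
  \rank (row_mx x y) = 2%N.
Proof.
move=> r1x r1y r2x r2y; apply/eqP; rewrite eqn_leq rank_leq_col /=.
apply: leq_trans (mxrankM_maxr (col_mx r1 r2) _).
rewrite mul_col_row [r1 *m x]mx11_scalar [r1 *m y]mx11_scalar [r2 *m x]mx11_scalar
  [r2 *m y]mx11_scalar r1x r1y r2x r2y raddf0.
by rewrite -scalar_mx_block mxrank1.
Qed.

End HullBasics.

Section Hull.
Variables (R : realType) (Q : finType) (pt : Q -> 'cV[R]_3).

Lemma convex_hull_le (a : 'rV[R]_3) b x : (forall q, (a *m pt q) 0 0 <= b) ->
  convex_hull (range pt) x -> (a *m x) 0 0 <= b.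
Proof.
move=> ab /convex_hull_finite[c [c0 c1 ->]].
rewrite mulmx_sumr summxE -[leRHS]mul1r -c1 mulr_suml; apply: ler_sum => q _.
by rewrite -scalemxAr mxE ler_wpM2l.
Qed.

(** A point of a supporting plane is a combination of the vertices that lie in
    this plane: the weighted distances of the vertices to the plane are
    nonnegative and sum to zero. *)
Lemma convex_hull_supporting (a : 'rV[R]_3) b x :
  (forall q, (a *m pt q) 0 0 <= b) ->
  convex_hull (range pt) x -> (a *m x) 0 0 = b -> exists c : Q -> R,
  [/\ \sum_q c q = 1, x = \sum_q c q *: pt q
    & forall q, (a *m pt q) 0 0 != b -> c q = 0].
Proof.
move=> ab /convex_hull_finite[c [c0 c1 xE]] xb; exists c; split=> // q qb.
have gap_ge0 p : true -> 0 <= c p * (b - (a *m pt p) 0 0).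
  by move=> _; rewrite mulr_ge0 // subr_ge0.
have gap0 : \sum_p c p * (b - (a *m pt p) 0 0) = 0.
  under eq_bigr do rewrite mulrBr.
  rewrite sumrB -mulr_suml c1 mul1r -{1}xb xE mulmx_sumr summxE.
  by apply/eqP; rewrite subr_eq0; apply/eqP/eq_bigr => p _; rewrite -scalemxAr mxE.
have := psumr_eq0P gap_ge0 gap0 (i := q) isT.
by move/eqP; rewrite mulf_eq0 subr_eq0 [b == _]eq_sym (negPf qb) orbF => /eqP.
Qed.

Lemma collinear_not_independent (p d u v w : 'cV[R]_3) :
  (forall x, x \in [:: u; v; w] -> exists m, x = p + m *: d) ->
  ~ affinely_independent u v w.
Proof.
move=> line.
have [[l ->] [m ->] [n ->]] : [/\ exists m, u = p + m *: d, exists m, v = p + m *: d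
   & exists m, w = p + m *: d].
  by split; apply: line; rewrite !inE eqxx ?orbT.
have sub (x y : R) : p + x *: d - (p + y *: d) = (x - y) *: d.
  by rewrite opprD addrACA subrr add0r scalerBl.
rewrite /affinely_independent !sub.
have -> : row_mx ((m - l) *: d) ((n - l) *: d) = d *m row_mx (m - l)%:M (n - l)%:M.
  by rewrite mul_mx_row !mul_mx_scalar.
move=> rk2; have := mxrankM_maxl d (row_mx (m - l)%:M (n - l)%:M).
by rewrite rk2 => /leq_trans/(_ (rank_leq_col d)).
Qed.

Lemma card_le2_cover (X : {set Q}) (q0 : Q) : (#|X| <= 2)%N ->
  exists p q, forall x, x \in X -> x = p \/ x = q.
Proof.
rewrite cardE; have := mem_enum X; case: (enum X) => [|p [|q [|//]]] E _.
- by exists q0, q0 => x; rewrite -E.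
- by exists p, p => x; rewrite -E inE => /eqP->; left.
by exists p, q => x; rewrite -E !inE => /orP[] /eqP->; [left|right].
Qed.

(** A face of dimension two contains three vertices: if at most two vertices lay in
    the supporting plane, its points in the hull would be collinear. *)
Lemma face_vertices (a : 'rV[R]_3) b u v w :
  (forall q, (a *m pt q) 0 0 <= b) ->
  (forall x, x \in [:: u; v; w] -> convex_hull (range pt) x /\ (a *m x) 0 0 = b) ->
  affinely_independent u v w ->
  (2 < #|[set q | (a *m pt q) 0%R 0%R == b]%SET|)%N.
Proof.
move=> ab on; rewrite ltnNge; apply: contraPN => le2.
have [q0 _] : exists q0 : Q, True.
  have [] := on u; first by rewrite inE eqxx.
  by move=> /convex_hull_finite[c [_ + _]] _; case: (pickP (@predT Q)) => [q|Q0];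
    [exists q | rewrite big_pred0 // => /eqP; rewrite eq_sym oner_eq0].
have [p [q pq]] := card_le2_cover q0 le2.
apply: (@collinear_not_independent (pt p) (pt q - pt p)) => x /on[xP xb].
have [c [c1 xE c0]] := convex_hull_supporting ab xP xb.
exists (c q); apply/eqP; rewrite -subr_eq0 opprD addrA subr_eq0; apply/eqP.
have -> : x - pt p = \sum_r c r *: (pt r - pt p).
  under eq_bigr do rewrite scalerBr.
  by rewrite sumrB -scaler_suml c1 scale1r -xE.
rewrite (bigD1 q) //= big1 ?addr0 // => r rq.
have [rb|rb] := eqVneq ((a *m pt r) 0 0) b; last by rewrite c0 // scale0r.
have [->|rq'] : r = p \/ r = q by apply: pq; rewrite finset.in_set rb.
  by rewrite subrr scaler0.
by rewrite rq' eqxx in rq.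
Qed.
End Hull.

(** * The symmetries of the tetrahedron *)

Section Geometry.
Variable R : realType.
Implicit Types (i j k : 'I_4) (s t : 'S_4) (x y : 'cV[R]_3).
Local Notation P := (@triakis_tetrahedron R).

(** (1, 1, 1), (1, -1, -1), (-1, 1, -1), (-1, -1, 1): the point [i.+1] keeps the
    sign of the coordinate [i] only. *)
Definition vtx i : 'cV[R]_3 :=
  \col_j (if (i == 0) || (i == j.+1 :> nat) then 1 else -1).

(** The four numbers [height i x], which sum to zero, serve as redundant symmetric
    coordinates of [x]: T_d only permutes them. *)
Definition height i (x : 'cV[R]_3) : R := ((vtx i)^T *m x) 0 0.

Lemma ord4P i : [\/ i = 0, i = 1, i = 2 | i = 3].
Proof.
case: i => -[|[|[|[|//]]]] ?;
  [constructor 1|constructor 2|constructor 3|constructor 4]; exact: val_inj.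
Qed.

Lemma height_vtx i j : height i (vtx j) = if i == j then 3 else -1.
Proof.
rewrite /height mxE !big_ord_recl big_ord0 !mxE.
by case: (ord4P i) => ->; case: (ord4P j) => -> /=; lra.
Qed.

Lemma sum_vtx : \sum_i vtx i = 0.
Proof.
apply/matrixP => a b; rewrite !big_ord_recl big_ord0 !mxE.
by case: a => -[|[|[|//]]] ? /=; lra.
Qed.

(** The vertices form a tight frame. *)
Lemma sum_vtx_outer : \sum_i vtx i *m (vtx i)^T = 4%:M.
Proof.
apply/matrixP => a b; rewrite !big_ord_recl big_ord0 !mxE !big_ord1 !mxE.
by case: a b => -[|[|[|//]]] ? [[|[|[|//]]] ?] /=; lra.
Qed.

Lemma outer_vtx i (y x : 'cV[R]_3) : y *m (vtx i)^T *m x = height i x *: y.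
Proof.
by rewrite -mulmxA [_^T *m x]mx11_scalar mul_mx_scalar.
Qed.

Lemma vtx_frame x : 4 *: x = \sum_i height i x *: vtx i.
Proof.
rewrite -mul_scalar_mx -sum_vtx_outer mulmx_suml.
by apply: eq_bigr => i _; exact: outer_vtx.
Qed.

Lemma height_lin i (c : R) x y : height i (c *: x + y) = c * height i x + height i y.
Proof. by rewrite /height mulmxDr -scalemxAr !mxE. Qed.

Lemma heightZ i (c : R) x : height i (c *: x) = c * height i x.
Proof. by rewrite /height -scalemxAr !mxE. Qed.

Lemma height_sum i (J : finType) (F : J -> 'cV[R]_3) :
  height i (\sum_j F j) = \sum_j height i (F j).
Proof. by rewrite /height mulmx_sumr summxE. Qed.

Lemma sum_height x : \sum_i height i x = 0.
Proof.
under eq_bigr do rewrite /height.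
have sumT : \sum_i (vtx i)^T = 0 by rewrite -raddf_sum sum_vtx raddf0.
by rewrite -summxE -mulmx_suml sumT mul0mx mxE.
Qed.

Lemma height_inj x y : (forall i, height i x = height i y) -> x = y.
Proof.
move=> xy; have n4 : (4 : R) != 0 by rewrite pnatr_eq0.
apply: (scalerI n4); rewrite !vtx_frame.
by apply: eq_bigr => i _; rewrite xy.
Qed.

(** The isometry that permutes the vertices of the tetrahedron as [s] does, written
    without a choice of basis thanks to the tight frame. *)
Definition symm s : 'M[R]_3 := 4^-1 *: \sum_i vtx (s i) *m (vtx i)^T.

Lemma symm_mul s x : symm s *m x = 4^-1 *: \sum_i height i x *: vtx (s i).
Proof.
rewrite /symm -scalemxAl mulmx_suml; congr (_ *: _).
by apply: eq_bigr => i _; exact: outer_vtx.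
Qed.

Lemma height_symm s i x : height (s i) (symm s *m x) = height i x.
Proof.
rewrite symm_mul heightZ height_sum.
rewrite (eq_bigr (fun j => (if j == i then 4 * height i x else 0) - height j x)).
  by rewrite sumrB -big_mkcond big_pred1_eq sum_height; field.
move=> j _; rewrite heightZ height_vtx (inj_eq perm_inj).
by have [->|_] := eqVneq j i; ring.
Qed.

Lemma symm_vtx s i : symm s *m vtx i = vtx (s i).
Proof.
apply: height_inj => j; rewrite -[j](permKV s) height_symm !height_vtx.
by rewrite (inj_eq perm_inj).
Qed.

Lemma mulmx_vtx_inj (A B : 'M[R]_3) : (forall i, A *m vtx i = B *m vtx i) -> A = B.
Proof.
move=> AB; have n4 : (4 : R) != 0 by rewrite pnatr_eq0.
apply: (scalerI n4); rewrite -!mul_mx_scalar -sum_vtx_outer !mulmx_sumr.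
by apply: eq_bigr => i _; rewrite !mulmxA AB.
Qed.

Lemma symm1 : symm 1%g = 1%:M.
Proof. by apply: mulmx_vtx_inj => i; rewrite symm_vtx perm1 mul1mx. Qed.

(** Permutations compose from left to right, matrices from right to left. *)
Lemma symmM s t : symm (s * t)%g = symm t *m symm s.
Proof. by apply: mulmx_vtx_inj => i; rewrite -mulmxA !symm_vtx permM. Qed.

Lemma symmV s : symm s \in unitmx /\ invmx (symm s) = symm s^-1%g.
Proof.
have ss : symm s^-1%g *m symm s = 1%:M by rewrite -symmM mulgV symm1.
have [_ U] := mulmx1_unit ss; split=> //.
by rewrite -[RHS](mulmxK U) ss mul1mx.
Qed.

(** The matrices R_0, R_1 and R_2 as vertex permutations: each is the reflection
    that exchanges two vertices of the tetrahedron. *)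
Definition generators : set 'M[R]_3 :=
  [set symm (tperm 1 2); symm (tperm 2 3); symm (tperm 0 3)].

(** Transpositions with the last point generate the symmetric group, and the one
    missing among the generators is a conjugate of one of them by another. *)
Lemma generated_symm : Defs.generated_group generators = range symm.
Proof.
apply/seteqP; split.
  apply: smallest_sub.
    split; first by exists 1%g => //; exact: symm1.
      by move=> _ _ [s _ <-] [t _ <-]; exists (t * s)%g; rewrite ?symmM.
    move=> _ [s _ <-]; have [U sV] := symmV s; split=> //.
    by rewrite sV; exists s^-1%g.
  by move=> _ [[]|] ->; eexists.
move=> _ [s _ <-] G [[G1 GM GV] gens].
pose H := [set s : 'S_4 | `[< G (symm s) >]]%SET.
have memH u : G (symm u) -> u \in H by move=> Gu; rewrite inE; exact: asboolT.
have Hmem u : u \in H -> G (symm u) by rewrite inE; exact: asboolW.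
have Hg : group_set H.
  apply/group_setP; split; first by apply: memH; rewrite symm1.
  by move=> u v /Hmem Gu /Hmem Gv; apply: memH; rewrite symmM; exact: GM.
have H12 : tperm 1 2 \in H by apply/memH/gens; left; left.
have H23 : tperm 2 3 \in H by apply/memH/gens; left; right.
have H03 : tperm 0 3 \in H by apply/memH/gens; right.
suff: s \in (Group Hg : {set _}) by exact: Hmem.
have: s \in [set: 'S_4]%SET by rewrite inE.
rewrite -(gen_tperm 3).
apply: fintype.subsetP; rewrite gen_subG; apply/fintype.subsetP => _ /imsetP[y _ ->].
case: (ord4P y) => ->.
- by rewrite tpermC.
- have <- : conjg (tperm 2 3) (tperm 1 2) = tperm 3 1 :> 'S_4.
    by rewrite tpermJ tpermR tpermD // tpermC.
  exact: (groupJ (G := Group Hg)).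
- by rewrite tpermC.
by rewrite tperm1; exact: (group1 (Group Hg)).
Qed.

Lemma TdE : @Td R = range symm.
Proof.
rewrite -generated_symm /Td /generators; congr Defs.generated_group.
have mxE3 s (A : 'M[R]_3) : (forall i, A *m vtx i = vtx (s i)) -> A = symm s.
  by move=> As; apply: mulmx_vtx_inj => i; rewrite symm_vtx.
congr [set _; _; _]; apply: mxE3 => i; apply/matrixP => a b; rewrite !mxE;
  rewrite !big_ord_recl big_ord0 !mxE /= permE /=;
  by case: (ord4P i) => ->; case: a => -[|[|[|//]]] ? /=; lra.
Qed.

(** * The faces of the triakis tetrahedron *)

(** The vertices of the tetrahedron, and the apexes of the low pyramids erected on
    its faces. *)
Definition solid_vtx (q : bool * 'I_4) : 'cV[R]_3 :=
  (if q.1 then 1 else - (3 / 5)) *: vtx q.2.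

Lemma triakis_hull : P = convex_hull (range solid_vtx).
Proof.
have orb (c : R) : orbit_of (@Td R) (const_mx c) = range (fun i => c *: vtx i).
  have v0 : const_mx c = c *: vtx 0.
    by apply/matrixP => a b; rewrite !mxE mulr1.
  rewrite TdE v0; apply/seteqP; split=> x [].
    by move=> _ [s _ <-] <-; exists (s 0) => //; rewrite -scalemxAr symm_vtx.
  move=> i _ <-; exists (symm (tperm 0 i)); first by exists (tperm 0 i).
  by rewrite -scalemxAr symm_vtx tpermL.
rewrite /triakis_tetrahedron !orb; congr convex_hull.
apply/seteqP; split => [_ [] [i _ <-]|_ [[[] i] _ <-]].
- by exists (true, i).
- by exists (false, i).
- by left; exists i.
- by right; exists i.
Qed.

Lemma solid_vtx_in q : P (solid_vtx q).
Proof. by rewrite triakis_hull; apply: sub_gen_smallest; exists q. Qed.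

Lemma vtx_in i : P (vtx i).
Proof. by have := solid_vtx_in (true, i); rewrite /solid_vtx scale1r. Qed.

Lemma symm_in s x : P x -> P (symm s *m x).
Proof.
rewrite {1}triakis_hull.
apply: (smallest_sub (X := [set x | P (symm s *m x)])) => [y z l|_ [[b i] _ <-]].
  move=> /set_mem yP /set_mem zP; apply/mem_set; rewrite /= convE mulmxDr -!scalemxAr.
  by apply/set_mem/convex_hull_convex; exact/mem_set.
rewrite /= -scalemxAr symm_vtx; exact: solid_vtx_in (b, s i).
Qed.

(** The pyramid face with apex over the tetrahedron face opposite to [vtx i] and
    with base the edge that avoids both [vtx i] and [vtx j]. *)
Definition face i j := P `&` [set x | 2 * height i x + height j x = - 3].

Lemma symm_face s i j : mulmx (symm s) @` face i j = face (s i) (s j).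
Proof.
apply/seteqP; split=> [_ [x [Px xE] <-]|x [Px xE]].
  by split; [exact: symm_in|rewrite /= !height_symm].
exists (symm s^-1 *m x).
  split; first exact: symm_in.
  by rewrite /= -[i](permK s) -[j](permK s) !height_symm.
by rewrite mulmxA -symmM mulVg symm1 mul1mx.
Qed.

Lemma face_vtx i j k : i != j -> face i j (vtx k) <-> k \notin [:: i; j].
Proof.
move=> ij; rewrite !inE negb_or /face /= !height_vtx !(eq_sym k).
split; last by move=> /andP[/negPf-> /negPf->]; split; [exact: vtx_in | lra].
by move=> [_]; have [_|_] := eqVneq i k; have [_|_] := eqVneq j k => //=; lra.
Qed.

Lemma face_apex i j k : i != j -> face i j (- (3 / 5) *: vtx k) <-> k = i.
Proof.
move=> ij; rewrite /face /= !heightZ !height_vtx.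
split=> [[_]|->]; last first.
  rewrite eqxx eq_sym (negPf ij); split; [exact: solid_vtx_in (false, i) | lra].
by have [->//|_] := eqVneq i k; have [_|_] := eqVneq j k => ?; exfalso; lra.
Qed.

Lemma face_inj i j i' j' : i != j -> i' != j' -> face i j = face i' j' ->
  i = i' /\ j = j'.
Proof.
move=> ij ij' E; have ii : i = i'.
  by apply/(face_apex i ij'); rewrite -E; exact/(face_apex i ij).
split=> //; have [jj|jNj'] := eqVneq j j'; first by [].
have /(face_vtx j ij) : face i j (vtx j).
  by rewrite E; apply/(face_vtx j ij'); rewrite // !inE negb_or -ii eq_sym ij.
by rewrite !inE eqxx orbT.
Qed.

Lemma sum_ord4 (F : 'I_4 -> R) i j k l : uniq [:: i; j; k; l] ->
  \sum_m F m = F i + F j + F k + F l.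
Proof.
move=> U; have all4 : 'I_4 =i [:: i; j; k; l].
  by apply/fsym/subset_cardP; [rewrite card_ord (card_uniqP U)|exact/fintype.subsetP].
rewrite (eq_bigl (mem [:: i; j; k; l])) => [|m]; last exact: (all4 m).
by rewrite -(big_uniq _ U) !big_cons big_nil /= addr0 !addrA.
Qed.

Lemma ord4_extend i j k : uniq [:: i; j; k] -> exists l, uniq [:: i; j; k; l].
Proof.
move=> U; have [l kl] : exists l, l \notin [:: i; j; k].
  apply/existsP; rewrite -negb_forall; apply/negP => /forallP all3.
  have := card_uniqP U; rewrite (eq_card (B := 'I_4)) ?card_ord //.
by exists l; rewrite -[X in uniq X]/(rcons [:: i; j; k] l) rcons_uniq kl.
Qed.

Lemma functional_frame (a : 'rV[R]_3) x :
  4 * (a *m x) 0 0 = \sum_k height k x * (a *m vtx k) 0 0.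
Proof.
transitivity ((a *m (4 *: x)) 0 0); first by rewrite -scalemxAr [RHS]mxE.
rewrite vtx_frame mulmx_sumr summxE; apply: eq_bigr => k _.
by rewrite -scalemxAr [LHS]mxE.
Qed.

Lemma sum_functional_vtx (a : 'rV[R]_3) : \sum_k (a *m vtx k) 0 0 = 0.
Proof. by rewrite -summxE -mulmx_sumr sum_vtx mulmx0 mxE. Qed.

(** Let [c] be the values of a linear form on the tetrahedron vertices, with maximum
    [b] on the solid.  A vertex and the apex opposite to it cannot both be
    maximal, so three maximal vertices have distinct indices.  As the values sum to
    zero, the fourth value is then -3b for three vertices and no apex, 7b/3 for one
    vertex and two apexes, 5b for three apexes; each violates a bound.  Only two
    vertices and one apex are left. *)
Lemma three_tight_vertices (c : 'I_4 -> R) b (p q r : bool * 'I_4) :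
  0 < b -> (forall k, c k <= b) -> (forall k, - (3 / 5) * c k <= b) ->
  \sum_k c k = 0 ->
  (if p.1 then 1 else - (3 / 5)) * c p.2 = b ->
  (if q.1 then 1 else - (3 / 5)) * c q.2 = b ->
  (if r.1 then 1 else - (3 / 5)) * c r.2 = b ->
  p != q -> q != r -> r != p ->
  exists i j k l, uniq [:: i; j; k; l] /\
    [/\ c k = b, c l = b & - (3 / 5) * c i = b].
Proof.
move=> b_gt0 top_le bot_le sumc.
have dist (x y : bool * 'I_4) : (if x.1 then 1 else - (3 / 5)) * c x.2 = b ->
    (if y.1 then 1 else - (3 / 5)) * c y.2 = b -> x != y -> x.2 != y.2.
  case: x y => [bx ix] [by_ iy] /= xb yb; apply: contraNneq => xy; move: xb yb.
  by rewrite -xy; case: bx; case: by_ => // *; exfalso; lra.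
move=> pb qb rb /(dist _ _ pb qb) pq /(dist _ _ qb rb) qr /(dist _ _ rb pb) rp.
case: p pb pq rp => [bp i] /= pb ij ki; case: q qb ij qr => [bq j] /= qb ij jk.
case: r rb jk ki => [br k] /= rb jk ki.
have U3 : uniq [:: i; j; k] by rewrite /= !inE negb_or ij jk eq_sym ki.
have [l U] := ord4_extend U3; rewrite (sum_ord4 _ U) in sumc.
have reorder (x : seq 'I_4) : perm_eq x [:: i; j; k; l] -> uniq x by move/perm_uniq->.
have := top_le l; have := bot_le l; move: pb qb rb.
case: bp; case: bq; case: br; rewrite ?mul1r => pb qb rb lo up; try (exfalso; lra).
- exists k, l, i, j; split=> //; apply: (reorder [:: k; l; i; j]).
  by apply/seq.permP => P /=; ring.
- exists j, l, i, k; split=> //; apply: (reorder [:: j; l; i; k]).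
  by apply/seq.permP => P /=; ring.
exists i, l, j, k; split=> //; apply: (reorder [:: i; l; j; k]).
by apply/seq.permP => P /=; ring.
Qed.

(** Three vertices of the solid determine the plane: the linear form takes the values
    -5b/3, -b/3, b, b on [vtx i], [vtx j] and the other two, hence it is a
    multiple of the one that defines [face i j]. *)
Lemma faces_triakisP (F : set 'cV[R]_3) :
  faces P F -> exists i j, i != j /\ F = face i j.
Proof.
move=> [a [b [a0 aP FE [u [v [w [Fu Fv Fw uvw]]]]]]].
set c := fun k => (a *m vtx k) 0 0.
have c_pt q : (a *m solid_vtx q) 0 0 = (if q.1 then 1 else - (3 / 5)) * c q.2.
  by rewrite /solid_vtx -scalemxAr mxE.
have pt_le q : (a *m solid_vtx q) 0 0 <= b by apply: aP; exact: solid_vtx_in.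
have top_le k : c k <= b by have := pt_le (true, k); rewrite c_pt mul1r.
have bot_le k : - (3 / 5) * c k <= b by have := pt_le (false, k); rewrite c_pt.
have b_gt0 : 0 < b.
  rewrite ltNge; apply/negP => b_le0; case/eqP: a0; apply/rowP => m.
  have c0 k : c k = 0 by have := top_le k; have := bot_le k; lra.
  rewrite [RHS]mxE; have := functional_frame a (delta_mx m 0); rewrite big1 => [|k _].
    by rewrite -colE mxE => /eqP; rewrite mulf_eq0 pnatr_eq0 => /eqP.
  by rewrite -/(c k) c0 mulr0.
have plane i j k l : uniq [:: i; j; k; l] -> c k = b -> c l = b ->
    - (3 / 5) * c i = b -> exists i j, i != j /\ F = face i j.
  move=> U ck cl ci; exists i, j; split.
    by move: U; rewrite /= !inE !negb_or => /and4P[/and3P[]].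
  have sumc := sum_functional_vtx a; rewrite (sum_ord4 _ U) in sumc.
  have key x : 3 * (a *m x) 0 0 = - b * (2 * height i x + height j x).
    have := functional_frame a x; have := sum_height x; rewrite !(sum_ord4 _ U).
    rewrite -/(c i) -/(c j) -/(c k) -/(c l) => /(congr1 ( *%R b)).
    have -> : c i = - (5 / 3) * b by lra.
    have -> : c j = - (1 / 3) * b by rewrite -/(c i) -/(c j) -/(c k) -/(c l) in sumc; lra.
    by rewrite ck cl; lra.
  rewrite FE; congr (_ `&` _); apply/seteqP; split=> x /=; have := key x.
    move=> /[swap] ->; rewrite mulrC mulNr -mulrN => /(mulfI (lt0r_neq0 b_gt0)).
    by lra.
  by move=> /[swap] ->; lra.
have on x : x \in [:: u; v; w] -> convex_hull (range solid_vtx) x /\ (a *m x) 0 0 = b.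
  rewrite -triakis_hull; have FF y : F y -> P y /\ (a *m y) 0 0 = b by rewrite FE.
  by rewrite !inE => /or3P[]/eqP->; exact: FF.
have := face_vertices pt_le on uvw.
move=> /card_gt2P[p [q [r [[]]]]]; rewrite !inE !c_pt.
move=> /eqP pb /eqP qb /eqP rb [pq qr rp].
have [i [j [k [l [U [ck cl ci]]]]]] :=
  three_tight_vertices b_gt0 top_le bot_le (sum_functional_vtx a) pb qb rb pq qr rp.
exact: plane U ck cl ci.
Qed.

Lemma height_sub k j x : ((vtx k - vtx j)^T *m x) 0 0 = height k x - height j x.
Proof. by rewrite raddfB mulmxBl [LHS]mxE [X in _ + X]mxE. Qed.

Lemma face_faces i j : i != j -> faces P (face i j).
Proof.
move=> ij; have [k [l [U _]]] := ord4_complement ij.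
pose a : 'rV[R]_3 := - (2 *: (vtx i)^T + (vtx j)^T).
have aE x : (a *m x) 0 0 = - (2 * height i x + height j x).
  rewrite mulNmx mulmxDl -scalemxAl [LHS]mxE; congr (- _).
  by rewrite [LHS]mxE [X in X + _]mxE.
move: U; rewrite /= !inE !negb_or => /and4P[/and3P[_ ik il] /andP[jk jl] kl _].
exists a, 3; split.
- apply/eqP => a0; have := aE (vtx i).
  by rewrite a0 mul0mx mxE !height_vtx eqxx eq_sym (negPf ij) => {a0}; lra.
- move=> x; rewrite triakis_hull; apply: convex_hull_le => -[b m].
  rewrite aE /solid_vtx !heightZ !height_vtx.
  have [im|_] := eqVneq i m; have [jm|_] := eqVneq j m; case: b => /=; try lra.
    by rewrite im jm eqxx in ij.
- by apply/seteqP; split=> x [Px /= xE]; split=> //=; move: xE; rewrite aE; lra.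
exists (- (3 / 5) *: vtx i), (vtx k), (vtx l); split.
- exact/(face_apex i ij).
- by apply/(face_vtx k ij); rewrite !inE negb_or !(eq_sym k) ik jk.
- by apply/(face_vtx l ij); rewrite !inE negb_or !(eq_sym l) il jl.
(* With the apex as origin, [vtx k] and [vtx l] have the forms
   1/4 (height k - height j) and 1/4 (height l - height j) as dual basis. *)
have dual m n : (4^-1 *: (vtx m - vtx j)^T *m (vtx n - - (3 / 5) *: vtx i)) 0 0 =
   4^-1 * ((if m == n then 3 else -1) + 3 / 5 * (if m == i then 3 else -1)
     - ((if j == n then 3 else -1) + 3 / 5 * (if j == i then 3 else -1))).
  rewrite -scalemxAl [LHS]mxE height_sub; congr (_ * _).
  have h m' : height m' (vtx n - - (3 / 5) *: vtx i)
      = height m' (vtx n) + 3 / 5 * height m' (vtx i).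
    by rewrite scaleNr opprK addrC height_lin addrC.
  by rewrite !h !height_vtx.
apply: (@rank2_of_dual _ (4^-1 *: (vtx k - vtx j)^T)
                         (4^-1 *: (vtx l - vtx j)^T)); rewrite dual.
all: rewrite ?eqxx ?(eq_sym k i) ?(eq_sym l i) ?(eq_sym j i) ?(eq_sym l k).
all: rewrite ?(negPf ik) ?(negPf il) ?(negPf jk) ?(negPf jl) ?(negPf kl).
all: rewrite ?(negPf ij); lra.
Qed.
End Geometry.

(** * Tilings of the faces as colourings of ordered pairs *)

Lemma card_fset_set_image (U : finType) (V : choiceType) (g : U -> V) (A : {set U}) :
  {in A &, injective g} ->
  finite_set (g @` [set` A]) /\ #|` fset_set (g @` [set` A])|%fset = #|A|.
Proof.
move=> g_inj.
have -> : g @` [set` A] = [set` [fset g x | x in A]%fset].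
  apply/seteqP; split=> [_ [x Ax <-]|y /= /imfsetP[x Ax ->]]; last by exists x.
  by apply/imfsetP; exists x.
split; first exact: finite_fset.
by rewrite set_fsetK card_in_imfset // -card_finset card_in_imfset.
Qed.

Lemma set_of_finset_image_inj (U : finType) V (g : U -> V) : injective g ->
  injective (fun A : {set U} => g @` [set` A]).
Proof.
move=> g_inj A B AB; apply/setP => x; apply/idP/idP => xX.
  have [y yB /g_inj <- //] : (g @` [set` B]) (g x) by rewrite -AB; exists x.
have [y yB /g_inj <- //] : (g @` [set` A]) (g x) by rewrite AB; exists x.
Qed.

Section Transport.
Variables (R : realType) (T : finType).
Notation P := (@triakis_tetrahedron R).
Variable D : tile_designs (@Td R) P T.
Implicit Types (p : opair) (s : 'S_4) (t : T).

Definition face_of p : faces P := SigSub (mem_set (face_faces R (valP p))).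

Lemma val_face_of p : val (face_of p) = @face R (val p).1 (val p).2.
Proof. by []. Qed.

Lemma face_of_inj : injective face_of.
Proof.
move=> p q /(congr1 val); rewrite !val_face_of => /(face_inj (valP p) (valP q))[].
by case: p q => -[i j] ? [[k l] ?] /= ? ?; apply: val_inj; congr pair.
Qed.

Lemma face_of_surj (F : faces P) : exists p, face_of p = F.
Proof.
have [i [j [ij FE]]] := faces_triakisP (set_valP F).
by exists (Sub (i, j) ij : opair); apply: val_inj; rewrite val_face_of.
Qed.

Lemma image_face_of s p :
  mulmx (symm R s) @` val (face_of p) = val (face_of (pair_act p s)).
Proof. by rewrite !val_face_of symm_face. Qed.

Lemma Td_symm s : Td (symm R s).
Proof. by rewrite TdE; exists s. Qed.

Lemma Td_eq_symm A : @Td R A -> exists s, A = symm R s.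
Proof. by rewrite TdE => -[s _ <-]; exists s. Qed.

Definition design_act (z : T * opair) s : T * opair :=
  ((D (symm R s) (z.1, face_of z.2)).1, pair_act z.2 s).

Lemma tile_act_symm s t p : D (symm R s) (t, face_of p) =
  ((design_act (t, p) s).1, face_of (pair_act p s)).
Proof.
apply: injective_projections => //; apply: val_inj => /=.
by rewrite (tile_act_over D _ (Td_symm s)) image_face_of.
Qed.

Lemma design_act_is_action : is_action [set: 'S_4]%SET design_act.
Proof.
apply: is_total_action => [[t p]|[t p] s u].
  by rewrite /design_act /= symm1 tile_act1 (act1 pair_action).
rewrite /design_act /= (actM pair_action) symmM; congr pair.
by rewrite (tile_actM D _ (Td_symm u) (Td_symm s)) tile_act_symm.
Qed.
Canonical design_action := Action design_act_is_action.

Lemma design_act_over (z : T * opair) s : (design_action z s).2 = pair_action z.2 s.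
Proof. by []. Qed.

Notation to := (tiling_action design_act_over).

(** Reading tilings on the twelve pairs is a bijection that intertwines both actions,
    hence carries orbits to orbits. *)
Lemma tiling_orbits_indexed : exists g : {ffun opair -> T} -> tiling P T,
  injective g /\
  tiling_orbits D = (fun O : {set {ffun opair -> T}} => g @` [set` O])
     @` [set` (orbit to [set: 'S_4] @: [set: {ffun opair -> T}])%SET].
Proof.
have [ix ixK] := choice face_of_surj.
have ixE p : ix (face_of p) = p by apply: face_of_inj; rewrite ixK.
pose g (tau : {ffun opair -> T}) : tiling P T := fun F => tau (ix F).
have gE (tau : {ffun opair -> T}) p : g tau (face_of p) = tau p by rewrite /g ixE.
have g_inj : injective g.
  by move=> tau sig E; apply/ffunP => p; rewrite -!gE E.
have g_surj (sig : tiling P T) : exists tau, g tau = sig.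
  by exists [ffun p => sig (face_of p)]; apply: funext => F; rewrite /g ffunE ixK.
have movesE tau s sig : moves_tiling D (symm R s) (g tau) sig <-> sig = g (to tau s).
  split=> [mv|-> F F'].
    apply: funext => F'; rewrite -(ixK F') -[ix F'](actKV pair_action s).
    set p := pair_action (ix F') s^-1%g.
    have -> : sig (face_of (pair_action p s))
        = (D (symm R s) (g tau (face_of p), face_of p)).1.
      by rewrite -(mv (face_of p) _ (esym (image_face_of s p))).
    rewrite tile_act_symm !gE.
    exact (congr1 fst (tiling_actP design_act_over tau s p)).
  rewrite -(ixK F) -(ixK F') image_face_of => /val_inj/face_of_inj ->.
  rewrite !gE tile_act_symm; congr pair.
  exact (esym (congr1 fst (tiling_actP design_act_over tau s (ix F)))).
exists g; split=> //.
have orbE tau : tiling_orbit D (g tau) = g @` [set` orbit to [set: 'S_4]%SET tau].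
  apply/seteqP; split=> [sig [A]|_ [_ /orbitP[s _ <-] <-]].
    move=> /Td_eq_symm[s ->] /movesE ->; exists (to tau s) => //=.
    by apply: mem_orbit; rewrite finset.in_setT.
  by exists (symm R s); [exact: Td_symm | apply/movesE].
apply/seteqP; split=> [_ [sig _ <-]|_ [O /imsetP[tau _ ->] <-]].
  have [tau <-] := g_surj sig; rewrite orbE; eexists; last by [].
  by apply: imset_f; rewrite inE.
by exists (g tau); rewrite ?orbE.
Qed.

(** The identity cannot exchange the two base vertices, which are distinct. *)
Lemma isosceles_reflection_moves (F : set 'cV[R]_3) f A :
  isosceles_reflection F f -> induces (@Td R) F f A -> A <> 1%:M.
Proof.
move=> [u [v [w [uvw FE _ _ [_ fv _]]]]] [_ _ fA] A1.
have Fv : F v by rewrite FE; apply: sub_gen_smallest; left; right.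
move: uvw; rewrite /affinely_independent -fv fA // A1 mul1mx.
apply: (@collinear_not_independent _ u (v - u)) => x; rewrite !inE => /or3P[]/eqP->.
- by exists 0; rewrite scale0r addr0.
- by exists 1; rewrite scale1r subrKC.
- by exists 1; rewrite scale1r subrKC.
Qed.

Lemma stabilizer_reflection p f : isosceles_reflection (val (face_of p)) f ->
  forall A, induces (@Td R) (val (face_of p)) f A ->
  exists2 s, A = symm R s & s != 1%g /\ pair_act p s = p.
Proof.
move=> f_refl A fA; have [/Td_eq_symm[s As] AF _] := fA; exists s => //; split.
  apply/eqP => s1; apply: (isosceles_reflection_moves f_refl fA).
  by rewrite As s1 symm1.
by apply/face_of_inj/val_inj; rewrite -image_face_of -As.
Qed.

(** [f] is induced by the only nontrivial symmetry that preserves [F].  Any face is the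
    image of [F] under some symmetry, which conjugates the corresponding
    stabilizers. *)
Lemma card_fixed_designs_reflection (F : faces P) f p s :
  induced_symmetry_group (@Td R) (val F) f -> isosceles_reflection (val F) f ->
  s != 1%g -> pair_act p s = p ->
  #|fixed_designs design_action p s| = fixed_tiles D F f.
Proof.
have [q <-] := face_of_surj F => -[A fA] f_refl s1 sp.
have [s0 As0 [s0_1 s0q]] := stabilizer_reflection f_refl fA.
have [u qu] := pair_act_trans q p.
have -> : s = (s0 ^ u)%g.
  apply: (pair_act_stab s1 _ sp); first by rewrite conjg_eq1.
  rewrite -qu -[LHS]/(pair_action (pair_action q u) (s0 ^ u)%g) conjgE.
  rewrite -actM mulKVg actM.
  by rewrite /= s0q.
rewrite -qu (card_fixed_designs_conj design_act_over).
apply: eq_card => t; rewrite finset.in_set.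
apply/eqP/asboolP => [fix_t|[B fB]].
  by exists A => //; rewrite As0 tile_act_symm -/(design_action _ _) fix_t /= s0q.
have [s' -> [s'1 s'q]] := stabilizer_reflection f_refl fB.
rewrite (pair_act_stab s'1 s0_1 s'q s0q) tile_act_symm => -[tE _].
by apply: injective_projections.
Qed.

End Transport.

Theorem theorem3 (R : realType) (T : finType)
    (D : tile_designs (@Td R) (@triakis_tetrahedron R) T)
    (F : faces (@triakis_tetrahedron R)) (f : 'cV[R]_3 -> 'cV[R]_3)
    (t_id t_f : nat)
    (f_induced : induced_symmetry_group (@Td R) (val F) f)
    (f_reflection : isosceles_reflection (val F) f)
    (card_tiles : #|T| = t_id)
    (card_fixed_tiles : fixed_tiles D F f = t_f) :
  finite_set (tiling_orbits D) /\
  (#|` fset_set (tiling_orbits D)|%fset%:R : rat) =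
    1 / 24 * (t_id%:R ^+ 12 + 8 * t_id%:R ^+ 4 + 3 * t_id%:R ^+ 6
              + 6 * t_id%:R ^+ 5 * t_f%:R ^+ 2 + 6 * t_id%:R ^+ 3).
Proof.
have [g [g_inj ->]] := tiling_orbits_indexed D.
have [fin ->] := card_fset_set_image
  (A := (orbit (tiling_action (design_act_over D)) [set: 'S_4]
           @: [set: {ffun opair -> T}])%SET)
  (in2W (set_of_finset_image_inj g_inj)).
split=> //; have := card_orbits (design_act_over D) (fun p s s1 sp =>
  card_fixed_designs_reflection D f_induced f_reflection s1 sp).
rewrite card_tiles card_fixed_tiles => orbits.
by apply: (@mulIf _ 24%:R) => //; rewrite -natrM orbits; field.
Qed.
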